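(* Let $\gamma(t)=1+\gamma_1t+\gamma_2t^2$ be a polynomial with integer coefficients $\gamma_1,\gamma_2$, and assume that every root of $\gamma(t)-t$ is real and negative. Then $h(t)=(1+t)^4\gamma\!\left(\frac{t}{(1+t)^2}\right)$ is the h-polynomial of a flag simplicial complex triangulating the $3$-sphere.
   Context: Simplicial complexes contain the empty face; $\#\sigma$ denotes the number of vertices of $\sigma$. Flag: every set of pairwise adjacent vertices is a face. f-polynomial $f_X(t)=\sum_{\sigma\in X}t^{\#\sigma}$. For $X$ triangulating $S^3$, the h-polynomial $h_X$ is defined by $(1+t)^4h_X(\frac1{1+t})=t^4f_X(\frac1t)$. *)

(* Defs.v *)
From HB Require Import structures.
From mathcomp Require Import all_boot all_order all_algebra all_field.
From mathcomp Require Import all_classical all_reals all_analysis.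
Set Implicit Arguments. Unset Strict Implicit. Unset Printing Implicit Defensive.
Import Order.TTheory GRing.Theory Num.Theory.
Import numFieldNormedType.Exports.
Local Open Scope ring_scope.

Definition simplicial_complex (n : nat) (X : {set {set 'I_n}}) : Prop :=
  (finset.set0 : {set 'I_n}) \in X /\ (forall s t : {set 'I_n}, s \in X -> t \subset s -> t \in X).

(* Flag: every set of pairwise adjacent vertices (including each vertex being
   a vertex of X) is a face. *)
Definition flag_complex (n : nat) (X : {set {set 'I_n}}) : Prop :=
  forall S : {set 'I_n},
    (forall x y, x \in S -> y \in S -> [set x; y] \in X) -> S \in X.

Definition fpoly (n : nat) (X : {set {set 'I_n}}) : {poly int} :=
  \sum_(s in X) 'X^#|s|.

(* h is the h-polynomial of X (X of dimension <= 3):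
   (1+t)^4 h(1/(1+t)) = t^4 f(1/t), written coefficientwise as a polynomial
   identity  sum_i f_i t^(4-i) = sum_j h_j (1+t)^(4-j). *)
Definition is_hpoly (n : nat) (X : {set {set 'I_n}}) (h : {poly int}) : Prop :=
  [/\ (size (fpoly X) <= 5)%N, (size h <= 5)%N &
      \sum_(i < 5) (fpoly X)`_i *: 'X^(4 - i)
      = \sum_(j < 5) h`_j *: ('X + 1) ^+ (4 - j)].

Local Open Scope classical_set_scope.

Definition geom_real (R : realType) (n : nat) (X : {set {set 'I_n}})
  : set 'rV[R]_n :=
  [set x | (forall i, 0 <= x ord0 i) /\ \sum_i x ord0 i = 1 /\
           finset (fun i => x ord0 i != 0) \in X].

Definition sphere3 (R : realType) : set 'rV[R]_4 :=
  [set y | \sum_i (y ord0 i) ^+ 2 = 1].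

Definition homeomorphic (R : realType) (m k : nat)
  (A : set 'rV[R]_m) (B : set 'rV[R]_k) : Prop :=
  exists (f : 'rV[R]_m -> 'rV[R]_k) (g : 'rV[R]_k -> 'rV[R]_m),
    [/\ {within A, continuous f}, {within B, continuous g},
        f @` A `<=` B, g @` B `<=` A &
        (forall x, A x -> g (f x) = x) /\ (forall y, B y -> f (g y) = y)].

Definition triangulates_S3 (R : realType) (n : nat) (X : {set {set 'I_n}}) : Prop :=
  homeomorphic (@geom_real R n X) (@sphere3 R).

Definition gammapoly (g1 g2 : int) : {poly int} := 1 + g1%:P * 'X + g2%:P * 'X^2.

(* h(t) = (1+t)^4 gamma(t/(1+t)^2) = (1+t)^4 + g1 t (1+t)^2 + g2 t^2 *)
Definition hgamma (g1 g2 : int) : {poly int} :=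
  ('X + 1) ^+ 4 + g1%:P * 'X * ('X + 1) ^+ 2 + g2%:P * 'X^2.

(* Main.v *)
Require Import Defs.
From HB Require Import structures.
From mathcomp Require Import all_boot all_order all_algebra all_field.
From mathcomp Require Import all_classical all_reals all_analysis.
From mathcomp Require Import ring lra zify.
Import Order.TTheory GRing.Theory Num.Theory.
Set Implicit Arguments. Unset Strict Implicit. Unset Printing Implicit Defensive.
Local Open Scope ring_scope.

(** In terms of gamma, the f-polynomial is the sum of gamma_i (t + t^2)^i (1 + 2t)^(4 - 2i).
    Subdividing an edge adds t + t^2 times the f-polynomial of its link, which for a cycle of length
    d + 4 is (1 + 2t)^2 + d (t + t^2); this gives the increments 1 and d. Only f-polynomials of
    links are tracked: no link has to be identified with a cycle. Each half of a subdivided edge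
    inherits the link polynomial of the whole edge, so the same gain can be collected repeatedly. A
    face that contains exactly one end of the edge keeps its link polynomial; as the two special
    edges share a vertex, subdividing one does not disturb the degree of the other. The obstacle is
    that the two special edges have the same link in the cross-polytope, because their other ends
    are antipodal: subdividing an edge of that link raises both degrees at once. Hence the
    symmetry-breaking subdivision, which costs one unit of gamma_1 and accounts for m + 1 instead of
    m. *)

(* The hypothesis says that g1 = m + 1 and 0 <= 4 g2 <= m^2.  Subdividing an edge
   of degree d + 4 in a flag 3-sphere adds 1 to gamma_1 and d to gamma_2, and
   gives another flag 3-sphere.  Put b = floor(m/2) and g2 = q b + c with
   0 <= c < b.  Starting from the boundary of the cross-polytope, one subdivision
   of an edge of degree 4 breaks the symmetry between two edges, and b further
   ones bring these two edges to degrees b + 4 and c + 4.  Subdividing the second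
   edge once (if c > 0) and the first one q times then adds q b + c = g2 to
   gamma_2; since g2 <= b (m - b), at most m + 1 subdivisions have been used, and
   more subdivisions of edges of degree 4 at the start bring their number to m + 1. *)

(** * Link polynomials under subdivision and suspension *)

Section LinkPolynomials.
Import fintype boot.finset.
Variable T : finType.
Implicit Types (X : {set {set T}}) (s u w : {set T}) (a b v p q : T) (l : seq T).

(** Weight of [u] in the f-polynomial of the link of [s]. The value 0 when [s] is not contained in
    [u] turns link polynomials into sums over all sets. *)
Definition relwt s u : {poly int} := if s \subset u then 'X^#|u :\: s| else 0.

Lemma relwtU1_notin a s u : a \notin s -> a \notin u -> relwt s (a |: u) = 'X * relwt s u.
Proof.
move=> aNs aNu; rewrite /relwt.
have -> : (s \subset a |: u) = (s \subset u).
  apply/idP/idP => [/subsetP su|]; last by move/subset_trans; apply; apply: subsetU1.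
  apply/subsetP => i si; have := su _ si; rewrite !inE => /orP[/eqP ia|//].
  by rewrite ia (negPf aNs) in si.
case: ifP; last by rewrite mulr0.
have -> : (a |: u) :\: s = a |: (u :\: s).
  by apply/setP => i; rewrite !inE; case: (eqVneq i a) => // ->; rewrite aNs.
by rewrite cardsU1 !inE (negPf aNu) andbF exprS.
Qed.

Lemma setU1D1 a b s : (a |: s) :\ b = if a == b then s :\ b else a |: (s :\ b).
Proof.
case: eqVneq => [->|ab]; apply/setP => i; rewrite !inE.
  by case: (i == b).
by case: (eqVneq i a) => // ->; rewrite ab.
Qed.

Lemma setD1_id b s : b \notin s -> s :\ b = s.
Proof. by move=> bs; apply/setP => i; rewrite !inE; case: eqVneq => // ->;
  rewrite (negPf bs). Qed.

Lemma relwtU1 a s u : a \notin u ->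
  relwt s (a |: u) = if a \in s then relwt (s :\ a) u else 'X * relwt s u.
Proof.
move=> aNu; case: ifPn => [ain|]; last by move=> ain; rewrite relwtU1_notin.
have e : s = a |: (s :\ a) by rewrite setD1K.
rewrite /relwt {1}e subUset sub1set setU11 /=.
have -> : (s :\ a \subset a |: u) = (s :\ a \subset u).
  by rewrite !subDset; congr (_ \subset _); rewrite setUA setUid.
congr (if _ then 'X^#|pred_of_set _| else _).
apply/setP => i; rewrite !inE; case: (eqVneq i a) => //= ->.
by rewrite ain (negPf aNu).
Qed.

Lemma relwt_U1l a s u : a \notin u -> relwt (a |: s) u = 0.
Proof. by move=> aNu; rewrite /relwt subUset sub1set (negPf aNu). Qed.

(* The f-polynomial of the link of the face with vertex list [l] (0 if it is not a face). *)
Definition lkpoly X l : {poly int} := \sum_(u in X | [set:: l] \subset u) 'X^#|u :\: [set:: l]|.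

Lemma lkpolyE X l : lkpoly X l = \sum_u (u \in X)%:R * relwt [set:: l] u.
Proof.
rewrite /lkpoly big_mkcond; apply: eq_bigr => u _; rewrite /relwt.
by case: (u \in X); case: (_ \subset u); rewrite /= ?mul1r ?mul0r.
Qed.

Lemma eq_lkpoly X l1 l2 : l1 =i l2 -> lkpoly X l1 = lkpoly X l2.
Proof.
move=> l12; have e : [set:: l1] = [set:: l2] by apply/setP => i; rewrite !inE l12.
by rewrite /lkpoly e.
Qed.

(** Pairing [u] with [v |: u]. Applied to several vertices in turn, it groups sets by their part
    outside these vertices, so that identities between link polynomials can be checked group by
    group. *)
Lemma sum_setU1 v (P : pred {set T}) (G : {set T} -> {poly int}) :
  (forall u, P (v |: u) = P u) ->
  \sum_(u | P u) G u = \sum_(u | P u && (v \notin u)) (G u + G (v |: u)).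
Proof.
move=> PU; rewrite (bigID (fun u : {set T} => v \notin u)) /= big_split /=; congr (_ + _).
rewrite (reindex_onto (fun u => v |: u) (fun u => u :\ v)) /=; last first.
  by move=> u; rewrite negbK => /andP[_ vu]; rewrite setD1K.
apply: eq_bigl => u; rewrite PU !inE eqxx /= andbT; congr (_ && _).
apply/eqP/idP => [<-|vNu]; first by rewrite !inE eqxx.
by apply/setP => i; rewrite !inE; case: (eqVneq i v) => // ->; rewrite (negPf vNu).
Qed.

Definition fresh v X := forall u, u \in X -> v \notin u.

Lemma freshU v X u : fresh v X -> (v |: u \in X) = false.
Proof. by move=> fv; apply/negP => /fv; rewrite !inE eqxx. Qed.

(* Subdivision of the edge [ab], with [v] as its midpoint. *)
Definition subdiv X a b v : {set {set T}} :=
  [set u : {set T} | ~~ ((a \in u) && (b \in u)) &&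
     (if v \in u then a |: (b |: (u :\ v)) \in X else u \in X)].

(** * Links after the subdivision of an edge *)

Section Subdivision.
Variables (X : {set {set T}}) (a b v : T).
Hypotheses (fv : fresh v X) (ab : a != b) (va : v != a) (vb : v != b).

Lemma sum_setU3 (Y : {set {set T}}) s : \sum_u (u \in Y)%:R * relwt s u =
  \sum_(u : {set T} | [&& v \notin u, a \notin u & b \notin u])
   let G u := (u \in Y)%:R * relwt s u in
   G u + G (b |: u) + (G (a |: u) + G (a |: (b |: u))) +
   (G (v |: u) + G (v |: (b |: u)) + (G (v |: (a |: u)) + G (v |: (a |: (b |: u))))).
Proof.
rewrite (sum_setU1 (v := v)) // (sum_setU1 (v := a)) => [|u]; last first.
  by rewrite !inE negb_or va.
rewrite (sum_setU1 (v := b)) => [|u]; last first.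
  by rewrite !inE !negb_or vb ab.
apply: eq_big => [u|u _]; first by rewrite -andbA.
rewrite /=; ring.
Qed.

Section Faces.
Variable u : {set T}.
Hypotheses (vu : v \notin u) (au : a \notin u) (bu : b \notin u).
Let E := (a |: (b |: u) \in X).
Let va' := negPf va. Let vb' := negPf vb. Let ab' := negPf ab.
Let av' : a == v = false. Proof. by rewrite eq_sym. Qed.
Let bv' : b == v = false. Proof. by rewrite eq_sym. Qed.
Let ba' : b == a = false. Proof. by rewrite eq_sym. Qed.
Let vu' := negPf vu. Let au' := negPf au. Let bu' := negPf bu.
Let S := (va', vb', ab', av', bv', ba', vu', au', bu', eqxx).

(** The definition of [subdiv] trades [v] for the whole edge [ab], so the three possible new faces
    over [u] all depend on the single condition [E]. *)
Lemma subdiv_faces :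
  (((u \in subdiv X a b v) = (u \in X)) *
  ((a |: u \in subdiv X a b v) = (a |: u \in X)) *
  ((b |: u \in subdiv X a b v) = (b |: u \in X)) *
  ((a |: (b |: u) \in subdiv X a b v) = false) *
  ((v |: u \in subdiv X a b v) = E) *
  ((v |: (a |: u) \in subdiv X a b v) = E) *
  ((v |: (b |: u) \in subdiv X a b v) = E) *
  ((v |: (a |: (b |: u)) \in subdiv X a b v) = false))%type.
Proof.
rewrite !inE !S /= ?setU1K ?inE ?S //=.
have aK w : a |: (a |: w) = a |: w by rewrite setUA setUid.
have bK w : b |: (b |: w) = b |: w by rewrite setUA setUid.
by rewrite (setUCA [set b]) aK bK.
Qed.
End Faces.

Lemma lkpoly_split l : lkpoly X l =
  \sum_(u : {set T} | [&& v \notin u, a \notin u & b \notin u])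
   let G u := (u \in X)%:R * relwt [set:: l] u in
   G u + G (b |: u) + (G (a |: u) + G (a |: (b |: u))).
Proof.
rewrite lkpolyE sum_setU3; apply: eq_bigr => u _ /=.
by rewrite !(freshU _ fv) !mul0r !addr0.
Qed.

Lemma lkpoly_subdiv_split l : lkpoly (subdiv X a b v) l =
  \sum_(u : {set T} | [&& v \notin u, a \notin u & b \notin u])
   let G u := (u \in X)%:R * relwt [set:: l] u in
   G u + G (b |: u) + G (a |: u) + (a |: (b |: u) \in X)%:R *
   (relwt [set:: l] (v |: u) + relwt [set:: l] (v |: (b |: u)) + relwt [set:: l] (v |: (a |: u))).
Proof.
rewrite lkpolyE sum_setU3; apply: eq_bigr => u /and3P[vu au bu] /=.
rewrite !(subdiv_faces vu au bu) !mulr0n; ring.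
Qed.

Let neqs : ((v == a) = false) * ((v == b) = false) * ((a == b) = false) *
  ((a == v) = false) * ((b == v) = false) * ((b == a) = false).
Proof. by rewrite [a == v]eq_sym [b == v]eq_sym [b == a]eq_sym !(negPf va, negPf vb,
  negPf ab). Qed.

(** Over each face of the link of [ab] and [l], the edge [ab] of weight ['X^2] is lost, and the
    vertex [v] with the edges [va] and [vb], of weight ['X + 'X^2 *+ 2], is gained. *)
Lemma lkpoly_subdiv_far l : v \notin l -> a \notin l -> b \notin l ->
  lkpoly (subdiv X a b v) l = lkpoly X l + ('X + 'X^2) * lkpoly X [:: a, b & l].
Proof.
move=> vl al bl; rewrite lkpoly_subdiv_split !lkpoly_split mulr_sumr -big_split /= !set_cons.
apply: eq_bigr => u /and3P[vu au bu]; rewrite !relwtU1 ?inE ?neqs //.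
rewrite !(setU1D1, neqs, eqxx, negPf vl, negPf al, negPf bl, orbT, inE) /= ?setD1_id ?inE //.
by rewrite !relwt_U1l //; ring.
Qed.

(** In the link of a face with the end [a] but not [b], the midpoint [v] merely takes the place of
    [b]. *)
Lemma lkpoly_subdiv_end l : v \notin l -> a \notin l -> b \notin l ->
  lkpoly (subdiv X a b v) (a :: l) = lkpoly X (a :: l).
Proof.
move=> vl al bl; rewrite lkpoly_subdiv_split !lkpoly_split /= !set_cons.
apply: eq_bigr => u /and3P[vu au bu]; rewrite !relwtU1 ?inE ?neqs //.
rewrite !(setU1D1, neqs, eqxx, negPf vl, negPf al, negPf bl, orbT, inE) /= ?setD1_id ?inE //.
by rewrite !relwt_U1l //; ring.
Qed.

(** This is what allows an edge to be subdivided again and again at the same degree: [av] replaces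
    [ab]. *)
Lemma lkpoly_subdiv_new_end l : v \notin l -> a \notin l -> b \notin l ->
  lkpoly (subdiv X a b v) [:: a, v & l] = lkpoly X [:: a, b & l].
Proof.
move=> vl al bl; rewrite lkpoly_subdiv_split !lkpoly_split /= !set_cons.
apply: eq_bigr => u /and3P[vu au bu]; rewrite !relwtU1 ?inE ?neqs //.
rewrite !(setU1D1, neqs, eqxx, negPf vl, negPf al, negPf bl, orbT, inE) /= ?setD1_id ?inE //.
by rewrite !relwt_U1l //; ring.
Qed.

(** The link of [v] is the suspension, with apexes [a] and [b], of the link of [ab]. *)
Lemma lkpoly_subdiv_new l : v \notin l -> a \notin l -> b \notin l ->
  lkpoly (subdiv X a b v) (v :: l) = (1 + 'X *+ 2) * lkpoly X [:: a, b & l].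
Proof.
move=> vl al bl; rewrite lkpoly_subdiv_split !lkpoly_split mulr_sumr /= !set_cons.
apply: eq_bigr => u /and3P[vu au bu]; rewrite !relwtU1 ?inE ?neqs //.
rewrite !(setU1D1, neqs, eqxx, negPf vl, negPf al, negPf bl, orbT, inE) /= ?setD1_id ?inE //.
by rewrite !relwt_U1l //; ring.
Qed.

End Subdivision.

(** A non-zero link polynomial certifies that [l] spans a face. With [cyclepoly_neq0], this
    separates a fresh vertex from the ends of any edge of known degree. *)
Lemma fresh_lkpoly v X l : fresh v X -> lkpoly X l != 0 -> v \notin l.
Proof.
move=> fv; apply: contra => vl; rewrite /lkpoly big_pred0 // => u.
apply/negP => /andP[/fv vu /subsetP/(_ v)]; rewrite inE => /(_ vl).
by rewrite (negPf vu).
Qed.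

(** * Suspensions and cross-polytopes *)

Definition susp p q X :=
  [set u : {set T} | ~~ ((p \in u) && (q \in u)) && (u :\ p :\ q \in X)].

Lemma suspC p q X : susp p q X = susp q p X.
Proof. by apply/setP => u; rewrite !inE (andbC (p \in u)) !setDDl setUC. Qed.

Section Suspension.
Variables (X : {set {set T}}) (p q : T).
Hypotheses (fp : fresh p X) (fq : fresh q X) (pq : p != q).

Lemma lkpoly_susp_split l : lkpoly (susp p q X) l =
  \sum_(u : {set T} | (p \notin u) && (q \notin u)) (u \in X)%:R *
    (relwt [set:: l] u + relwt [set:: l] (p |: u) + relwt [set:: l] (q |: u)).
Proof.
rewrite lkpolyE (sum_setU1 (v := p)) // (sum_setU1 (v := q)) => [|u]; last first.
  by rewrite !inE negb_or pq.
apply: eq_big => [u|u /andP[pu qu]]; first by rewrite -andbA.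
have qp : q == p = false by rewrite eq_sym (negPf pq).
rewrite /= !inE !(setU1D1, negPf pu, negPf qu, eqxx, negPf pq, qp, orbT) /=.
rewrite !setD1_id ?inE ?(negPf pu) //.
by rewrite mulr0n; ring.
Qed.

Lemma lkpoly_base_split l : lkpoly X l =
  \sum_(u : {set T} | (p \notin u) && (q \notin u)) (u \in X)%:R * relwt [set:: l] u.
Proof.
rewrite lkpolyE (sum_setU1 (v := p)) // (sum_setU1 (v := q)) => [|u]; last first.
  by rewrite !inE negb_or pq.
apply: eq_big => [u|u _]; first by rewrite -andbA.
by rewrite !(freshU _ fp, freshU _ fq) !mul0r !addr0.
Qed.

Lemma lkpoly_susp l : p \notin l -> q \notin l ->
  lkpoly (susp p q X) l = (1 + 'X *+ 2) * lkpoly X l.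
Proof.
move=> pl ql; rewrite lkpoly_susp_split lkpoly_base_split mulr_sumr.
apply: eq_bigr => u /andP[pu qu].
by rewrite !relwtU1 ?inE // (negPf pl) (negPf ql); ring.
Qed.

Lemma lkpoly_susp_cons l : p \notin l -> q \notin l -> lkpoly (susp p q X) (p :: l) = lkpoly X l.
Proof.
move=> pl ql; rewrite lkpoly_susp_split lkpoly_base_split; apply: eq_bigr => u /andP[pu qu].
rewrite set_cons !relwtU1 ?inE // eqxx eq_sym (negPf pq) (negPf ql) /=.
by rewrite setU1D1 eqxx setD1_id ?inE // !relwt_U1l //; ring.
Qed.

Lemma lkpoly_susp_both l : p \in l -> q \in l -> lkpoly (susp p q X) l = 0.
Proof.
move=> pl ql; rewrite /lkpoly big_pred0 // => u; apply/negP => /andP[+ /subsetP lu].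
by rewrite inE !lu ?inE.
Qed.

End Suspension.

Definition crosspoly (ps : seq (T * T)) : {set {set T}} :=
  foldr (fun pq => susp pq.1 pq.2) [set set0] ps.

Lemma uniq_pairs p q ps : uniq ((p :: unzip1 ps) ++ (q :: unzip2 ps)) ->
  [/\ p != q, p \notin unzip1 ps ++ unzip2 ps, q \notin unzip1 ps ++ unzip2 ps
    & uniq (unzip1 ps ++ unzip2 ps)].
Proof.
move=> U; have : uniq [:: p, q & unzip1 ps ++ unzip2 ps].
  rewrite -(perm_uniq (_ : perm_eq ((p :: unzip1 ps) ++ (q :: unzip2 ps)) _)) //.
  by rewrite /= perm_cons -cat1s perm_catCA.
by rewrite /= inE negb_or -!andbA => /and4P[].
Qed.

Lemma in_cross ps u : uniq (unzip1 ps ++ unzip2 ps) ->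
  (u \in crosspoly ps) = all (fun pq => ~~ ((pq.1 \in u) && (pq.2 \in u))) ps &&
    (u \subset [set:: unzip1 ps ++ unzip2 ps]).
Proof.
elim: ps u => [|[p q] ps IH] u; first by rewrite /= set_nil subset0 inE.
move=> /uniq_pairs[pq pN qN U]; rewrite /= inE IH // -andbA; congr (_ && (_ && _)).
  apply: eq_in_all => -[r1 r2] rps; rewrite !inE /=.
  have r1N : r1 \in unzip1 ps ++ unzip2 ps by rewrite mem_cat (map_f fst rps).
  have r2N : r2 \in unzip1 ps ++ unzip2 ps by rewrite mem_cat (map_f snd rps) orbT.
  have ne (r s : T) : r \in unzip1 ps ++ unzip2 ps -> s \notin unzip1 ps ++ unzip2 ps ->
    r == s = false.
    by move=> rN; apply: contraNF => /eqP <-.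
  by rewrite !ne.
apply/subsetP/subsetP => us i; last first.
  rewrite !inE => /and3P[iq ip /us]; rewrite !inE !mem_cat inE.
  by rewrite (negPf ip) (negPf iq).
move=> iu; have := us i; rewrite !inE iu !mem_cat inE.
by case: (i == p) => //=; case: (i == q); rewrite ?orbT //= => /(_ isT).
Qed.

Lemma fresh_cross ps v : uniq (unzip1 ps ++ unzip2 ps) ->
  v \notin unzip1 ps ++ unzip2 ps -> fresh v (crosspoly ps).
Proof.
move=> U vps u; rewrite in_cross // => /andP[_ /subsetP us]; apply/negP => /us.
by rewrite inE (negPf vps).
Qed.

Lemma lkpoly_cross_cons p q ps l : uniq ((p :: unzip1 ps) ++ (q :: unzip2 ps)) ->
  lkpoly (crosspoly ((p, q) :: ps)) l =
  if p \in l then if q \in l then 0 else lkpoly (crosspoly ps) [seq i <- l | i != p]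
  else if q \in l then lkpoly (crosspoly ps) [seq i <- l | i != q]
  else (1 + 'X *+ 2) * lkpoly (crosspoly ps) l.
Proof.
move=> U.
have [pq pN qN U0] := uniq_pairs U.
have [fp fq] := (fresh_cross U0 pN, fresh_cross U0 qN).
have filt r : r \in l -> lkpoly (susp p q (crosspoly ps)) l = lkpoly (susp p q (crosspoly ps))
  (r :: [seq i <- l | i != r]).
  by move=> rl; apply: eq_lkpoly => i; rewrite inE mem_filter; case: eqVneq => // ->.
rewrite /=; case: ifPn => pl; case: ifPn => ql.
- exact: lkpoly_susp_both.
- by rewrite (filt p) // lkpoly_susp_cons // mem_filter ?eqxx // (negPf ql) andbF.
- by rewrite (filt q) // suspC lkpoly_susp_cons ?mem_filter ?eqxx ?(negPf pl) ?andbF // eq_sym.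
- by rewrite lkpoly_susp.
Qed.

Lemma lkpoly_cross0 l : lkpoly (crosspoly [::]) l = (l == [::])%:R.
Proof.
rewrite /lkpoly /=; case: l => [|x l].
  rewrite (big_pred1 set0) => [|u]; first by rewrite setDv cards0.
  by rewrite inE andb_idr // => /eqP ->; apply/subsetP => i; rewrite inE.
rewrite big_pred0 // => u; rewrite inE set_cons subUset sub1set.
by case: eqP => // ->; rewrite inE.
Qed.

(* The f-polynomial of a cycle of length [d + 4]. *)
Definition cyclepoly (d : nat) : {poly int} := (1 + 'X *+ 2) ^+ 2 + ('X + 'X^2) *+ d.

(* The f-polynomial of a 3-sphere with gamma polynomial [1 + k t + g t^2]. *)
Definition fgamma (k g : nat) : {poly int} :=
  (1 + 'X *+ 2) ^+ 4 + ('X + 'X^2) * (1 + 'X *+ 2) ^+ 2 *+ k + ('X + 'X^2) ^+ 2 *+ g.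

Lemma cyclepoly_neq0 d : cyclepoly d != 0.
Proof.
apply/negP => /eqP /(congr1 (horner_eval 0)).
by rewrite /cyclepoly rmorphD rmorphXn rmorphMn /= /horner_eval !hornerE expr0n mul0rn; move/eqP.
Qed.

(* [k] counts the subdivisions and [g] adds up the excesses over 4 of the degrees
   of the subdivided edges. *)
Inductive built X0 : {set {set T}} -> nat -> nat -> Prop :=
| built_base : built X0 X0 0 0
| built_subdiv X k g a b v d : built X0 X k g -> fresh v X -> a != b ->
    lkpoly X [:: a; b] = cyclepoly d -> built X0 (subdiv X a b v) k.+1 (g + d).

Lemma lkpoly_built X0 X k g : lkpoly X0 [::] = fgamma 0 0 -> built X0 X k g ->
  lkpoly X [::] = fgamma k g.
Proof.
move=> F0; elim=> // {}X {}k {}g a b v d _ IH fv ab e.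
have /norP[va /norP[vb _]] : v \notin [:: a; b].
  by apply: (fresh_lkpoly fv); rewrite e cyclepoly_neq0.
by rewrite lkpoly_subdiv_far // IH e /fgamma /cyclepoly; ring.
Qed.

(** One new vertex per subdivision: this bound guarantees a fresh vertex as long as the ambient type
    is large enough. *)
Lemma built_supp X0 X k g (V0 : {set T}) : (forall u, u \in X0 -> u \subset V0) ->
  built X0 X k g ->
  exists2 V : {set T}, (#|V| <= #|V0| + k)%N & forall u, u \in X -> u \subset V.
Proof.
move=> X0V; elim=> [|{}X {}k {}g a b v d _ [V cV XV] fv ab _]; first by exists V0; rewrite ?addn0.
exists (v |: V); first by rewrite cardsU1 addnS; case: (v \notin V);
  rewrite ?add0n ?add1n ?ltnS ?(leqW cV).
move=> u; rewrite inE => /andP[_].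
case: ifPn => vu /XV /subsetP uV; apply/subsetP => i iu; rewrite !inE.
  by case: eqVneq => //= iv; apply: uV; rewrite !inE iv iu !orbT.
by rewrite uV ?orbT.
Qed.

Lemma cyclepoly0 : (1 + 'X *+ 2) ^+ 2 = cyclepoly 0.
Proof. by rewrite /cyclepoly mulr0n addr0. Qed.

Lemma cyclepolyS d : cyclepoly d + ('X + 'X^2) = cyclepoly d.+1.
Proof. by rewrite /cyclepoly -addrA -mulrSr. Qed.

End LinkPolynomials.

(** * The sequence of subdivisions *)

Ltac by_cases_eq := repeat match goal with |- context[?a == ?b] => case: (a == b) end.

Section EdgeSubdivisions.
Import fintype boot.finset.
Variable T : finType.
Implicit Types (X : {set {set T}}) (s u : {set T}) (a b v p q : T) (l : seq T).

Section Construction.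
Variables (X0 : {set {set T}}) (x0 x1 x2 y1 y2 : T) (N0 : nat).
Hypothesis fresh_ex : forall X k g, built X0 X k g -> (k < N0)%N -> exists v, fresh v X.

Ltac neqs := repeat match goal with
  | H : is_true (?a != ?b) |- context[?a == ?b] => rewrite (negPf H)
  | H : is_true (?a != ?b) |- context[?b == ?a] => rewrite [b == a]eq_sym (negPf H)
  | H : is_true (?a \notin ?l) |- _ => rewrite ?inE ?negb_or in H
  | H : is_true (_ && _) |- _ => move/andP: H => [? ?]
  end.

Hypotheses (x01 : x0 != x1) (x02 : x0 != x2) (x12 : x1 != x2) (y12 : y1 != y2)
  (x0y1 : x0 != y1) (x0y2 : x0 != y2) (x1y1 : x1 != y1) (x1y2 : x1 != y2)
  (x2y1 : x2 != y1) (x2y2 : x2 != y2).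

(* In the 4-cycles x0 x1 x2 x3 and y0 y1 y2 y3, whose join is the initial sphere,
   the edges x0x1 and x1x2 are the ones whose degrees are to be raised, to b and
   to c <= b.  Stage 1 subdivides x0z (z = y0 at first), so that y1z leaves the
   link of x1x2 but not that of x0x1.  Stage 2 subdivides y1w (w = y2 at first),
   which lies in both links; stage 3 subdivides y1z, which lies only in the link
   of x0x1.  All these edges keep degree 4. *)
Definition stage1 X (z : T) :=
  [/\ z \notin [:: x0; x1; x2; y1; y2],
    [/\ lkpoly X [:: x0; z] = cyclepoly 0, lkpoly X [:: x0; z;
      y1] = 1 + 'X *+ 2, lkpoly X [:: x0; z; y1; x1] = 1
      & lkpoly X [:: z; y1] = cyclepoly 0],
    [/\ lkpoly X [:: x1; x2] = cyclepoly 0, lkpoly X [:: x0; x1] = cyclepoly 0, lkpoly X [:: y1;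
      y2] = cyclepoly 0,
      lkpoly X [:: y1; y2; x1; x2] = 1 & lkpoly X [:: y1; y2; x0; x1] = 1]
    & [/\ lkpoly X [:: x0; z; x1; x2] = 0, lkpoly X [:: x0; z; y1; y2] = 0,
      lkpoly X [:: x0; z; y1; x1; x2] = 0 & lkpoly X [:: x0; z; y1; y2; x1; x2] = 0]].

Definition stage2 X (z w : T) c :=
  [/\ z \notin [:: x0; x1; x2; y1], w \notin [:: x0; x1; x2; y1; z],
    [/\ lkpoly X [:: y1; w] = cyclepoly 0, lkpoly X [:: y1; w; x1; x2] = 1 & lkpoly X [:: y1; w;
      x0; x1] = 1],
    [/\ lkpoly X [:: y1; z] = cyclepoly 0, lkpoly X [:: y1; z; x0; x1] = 1 & lkpoly X [:: y1; z;
      x1; x2] = 0]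
    & lkpoly X [:: x1; x2] = cyclepoly c /\ lkpoly X [:: x0; x1] = cyclepoly c].

Definition stage3 X z (b c : nat) :=
  [/\ z \notin [:: x0; x1; x2; y1],
    [/\ lkpoly X [:: y1; z] = cyclepoly 0, lkpoly X [:: y1; z; x0; x1] = 1 & lkpoly X [:: y1; z;
      x1; x2] = 0]
    & lkpoly X [:: x1; x2] = cyclepoly c /\ lkpoly X [:: x0; x1] = cyclepoly b].

(** The zeros in [stage1] say that [x0z] is not in the links of the faces spanned by [x1x2], by
    [y1y2] and by both together, whose link polynomials are therefore unchanged ([D]); in faces
    through [x0] and [z], the midpoint replaces [z] ([E]). The second conclusion holds because [y1],
    [x1], [x2] do not span a face of the link of [x0z]. *)
Lemma stage1_subdiv X z v : fresh v X -> stage1 X z ->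
  stage1 (subdiv X x0 z v) v /\ lkpoly (subdiv X x0 z v) [:: y1; v; x1; x2] = 0.
Proof.
move=> fv [zN [h1 h2 h3 h4] [l1 l2 l3 l4 l5] [n1 n2 n3 n4]].
have vh : v \notin [:: x0; z] by apply: (fresh_lkpoly fv); rewrite h1 cyclepoly_neq0.
have v1 : v \notin [:: x1; x2] by apply: (fresh_lkpoly fv); rewrite l1 cyclepoly_neq0.
have v2 : v \notin [:: y1; y2] by apply: (fresh_lkpoly fv); rewrite l3 cyclepoly_neq0.
neqs.
have lk4 l : all (mem [:: y1; y2; x1; x2]) l ->
  [/\ v \notin l, x0 \notin l & z \notin l].
  by move/allP => sub; split; apply/negP => /sub; rewrite /= !inE; neqs.
have z0 : x0 != z by rewrite eq_sym.
have E l : all (mem [:: y1; y2; x1; x2]) l ->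
    lkpoly (subdiv X x0 z v) [:: x0, v & l] = lkpoly X [:: x0, z & l].
  by move=> /lk4[? ? ?]; rewrite lkpoly_subdiv_new_end.
have D l : all (mem [:: y1; y2; x1; x2]) l ->
    lkpoly X [:: x0, z & l] = 0 -> lkpoly (subdiv X x0 z v) l = lkpoly X l.
  by move=> /lk4[? ? ?] e; rewrite lkpoly_subdiv_far // e mulr0 addr0.
split; last first.
  rewrite (@eq_lkpoly _ _ _ [:: v; y1; x1; x2]) => [|i]; last by rewrite !inE orbCA.
  by rewrite lkpoly_subdiv_new ?n3 ?mulr0 // !inE; neqs.
split.
- by rewrite !inE; neqs.
- rewrite !E /= ?inE ?eqxx ?orbT //; split=> //.
  rewrite (lkpoly_subdiv_new _ _ _ _ (l := [:: y1])) ?h2 -?expr2 ?inE; neqs => //.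
  by rewrite cyclepoly0.
- split.
  + by rewrite D /= ?inE ?eqxx ?orbT.
  + by rewrite lkpoly_subdiv_end ?l2 ?inE; neqs.
  + by rewrite D /= ?inE ?eqxx ?orbT.
  + by rewrite D /= ?inE ?eqxx ?orbT.
  + rewrite (@eq_lkpoly _ _ _ [:: x0; y1; y2; x1]) => [|i]; last by rewrite !inE; by_cases_eq.
    rewrite lkpoly_subdiv_end ?inE //; neqs => //.
    rewrite -l5; apply: eq_lkpoly => i; by rewrite !inE; by_cases_eq.
- by rewrite !E /= ?inE ?eqxx ?orbT.
Qed.

(** The edge [y1w] lies in the links of both special edges, with trivial remaining link, so each
    gains exactly ['X + 'X^2]. The data on [y1z] survive because [y1] is an end of the subdivided
    edge. *)
Lemma stage2_subdiv X (z w : T) c v : fresh v X -> stage2 X z w c ->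
  stage2 (subdiv X y1 w v) z v c.+1.
Proof.
move=> fv [zN wN [w1 w2 w3] [g1 g2 g3] [e1 e2]].
have v1 : v \notin [:: y1; w] by apply: (fresh_lkpoly fv); rewrite w1 cyclepoly_neq0.
have v2 : v \notin [:: x1; x2] by apply: (fresh_lkpoly fv); rewrite e1 cyclepoly_neq0.
have v3 : v \notin [:: x0; x1] by apply: (fresh_lkpoly fv); rewrite e2 cyclepoly_neq0.
have v4 : v \notin [:: y1; z] by apply: (fresh_lkpoly fv); rewrite g1 cyclepoly_neq0.
neqs.
have yw : y1 != w by rewrite eq_sym.
split; rewrite ?inE; neqs => //.
- by rewrite !lkpoly_subdiv_new_end ?inE; neqs.
- by rewrite !lkpoly_subdiv_end ?inE; neqs.
- rewrite !lkpoly_subdiv_far ?inE; neqs => //.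
  by rewrite w2 w3 e1 e2 mulr1 cyclepolyS.
Qed.

Lemma stage3_subdiv X z (b c : nat) v : fresh v X -> stage3 X z b c ->
  stage3 (subdiv X y1 z v) v b.+1 c.
Proof.
move=> fv [zN [g1 g2 g3] [e1 e2]].
have v2 : v \notin [:: x1; x2] by apply: (fresh_lkpoly fv); rewrite e1 cyclepoly_neq0.
have v3 : v \notin [:: x0; x1] by apply: (fresh_lkpoly fv); rewrite e2 cyclepoly_neq0.
have v4 : v \notin [:: y1; z] by apply: (fresh_lkpoly fv); rewrite g1 cyclepoly_neq0.
neqs.
have yz : y1 != z by rewrite eq_sym.
split; rewrite ?inE; neqs => //.
- by rewrite !lkpoly_subdiv_new_end ?inE; neqs.
- rewrite !lkpoly_subdiv_far ?inE; neqs => //.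
  by rewrite g2 g3 e1 e2 mulr1 mulr0 addr0 cyclepolyS.
Qed.

(** The bound [N0] on the total number of subdivisions is a premise here, so that the stages chain
    without a separate record of the vertices still available. *)
Definition extends X k g n d (P : {set {set T}} -> Prop) :=
  built X0 X k g -> (k + n <= N0)%N -> exists X', built X0 X' (k + n) (g + d) /\ P X'.

(** At least one subdivision is made: the vanishing for [y1], [z'], [x1], [x2], which is the broken
    symmetry, fails in the cross-polytope itself. Further ones only raise the count [k]. *)
Lemma stage1_iter n X z : stage1 X z -> forall k g, extends X k g n.+1 0 (fun X' =>
  exists z', stage1 X' z' /\ lkpoly X' [:: y1; z'; x1; x2] = 0).
Proof.
elim: n X z => [|n IH] X z st k g bX kN.
all: have [v fv] : exists v, fresh v X by apply: (fresh_ex bX); apply: leq_trans kN;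
  rewrite addnS ltnS leq_addr.
all: have [st' n'] := stage1_subdiv fv st.
all: have [zN [h1 _ _ _] _ _] := st.
all: have x0z : x0 != z by move: zN; rewrite inE negb_or eq_sym => /andP[].
all: have bX' := built_subdiv bX fv x0z h1.
  by exists (subdiv X x0 z v); rewrite addn1; split=> //; exists v.
by rewrite -addSnnS in kN *; rewrite -{1}[g]addn0; apply: IH st' _ _ bX' kN.
Qed.

Lemma stage2_iter c X z w c0 : stage2 X z w c0 -> forall k g, extends X k g c 0 (fun X' =>
  exists w', stage2 X' z w' (c0 + c)).
Proof.
elim: c X w c0 => [|n IH] X w c0 st k g bX kN.
  by exists X; rewrite !addn0; split=> //; exists w.
have [v fv] : exists v, fresh v X by apply: (fresh_ex bX); apply: leq_trans kN;
  rewrite addnS ltnS leq_addr.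
have st' := stage2_subdiv fv st.
have [_ wN [h1 _ _] _ _] := st.
have y1w : y1 != w by move: wN; rewrite !inE !negb_or ![w == _]eq_sym => /and5P[].
have bX' := built_subdiv bX fv y1w h1.
rewrite -addSnnS in kN *; rewrite -(addSnnS c0) -{1}[g]addn0; exact: IH st' _ _ bX' kN.
Qed.

Lemma stage3_iter d X z (b c : nat) : stage3 X z b c -> forall k g, extends X k g d 0 (fun X' =>
  exists z', stage3 X' z' (b + d) c).
Proof.
elim: d X z b => [|n IH] X z b st k g bX kN.
  by exists X; rewrite !addn0; split=> //; exists z.
have [v fv] : exists v, fresh v X by apply: (fresh_ex bX); apply: leq_trans kN;
  rewrite addnS ltnS leq_addr.
have st' := stage3_subdiv fv st.
have [zN [h1 _ _] _] := st.
have y1z : y1 != z by move: zN; rewrite !inE !negb_or ![z == _]eq_sym => /and4P[].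
have bX' := built_subdiv bX fv y1z h1.
rewrite -addSnnS in kN *; rewrite -(addSnnS b) -{1}[g]addn0; exact: IH st' _ _ bX' kN.
Qed.

(** After each subdivision of [x1w], the half at [x1] takes over with the same link polynomial, so
    every step gains [b]. *)
Lemma stage4_iter (q : nat) X (w : T) (b : nat) : x1 != w -> lkpoly X [:: x1; w] = cyclepoly b ->
  forall k g, extends X k g q (q * b) (fun=> True).
Proof.
elim: q X w => [|n IH] X w xw e k g bX kN; first by exists X; rewrite !addn0.
have [v fv] : exists v, fresh v X by apply: (fresh_ex bX); apply: leq_trans kN;
  rewrite addnS ltnS leq_addr.
have vN : v \notin [:: x1; w] by apply: (fresh_lkpoly fv); rewrite e cyclepoly_neq0.
move: vN; rewrite !inE negb_or => /andP[vx vw].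
have bX' := built_subdiv bX fv xw e.
rewrite -addSnnS in kN *; rewrite mulSn addnA.
by apply: (IH _ v) bX' kN; rewrite 1?eq_sym // lkpoly_subdiv_new_end.
Qed.

Lemma exists_built_from_stage1 m g z : stage1 X0 z -> (4 * g <= m ^ 2)%N -> (m.+1 <= N0)%N ->
  exists X, built X0 X m.+1 g.
Proof.
move=> st gm mN.
(* This [b] maximises [b * (m - b)]: [b] subdivisions raise the degree, and [m - b] remain to
   collect a gain of at most [b] each. The summand [r] counts the subdivision of [x1x2], made only
   if [c > 0]. *)
pose b := m./2; pose q := (g %/ b)%N; pose c := (g %% b)%N; pose r : nat := (0 < c)%N.
have gE : g = (q * b + c)%N := divn_eq g b.
(* If [b = 0], the remainder is [g] itself by convention, but then [m <= 1] forces [g = 0]. *)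
have cb : (c <= b)%N.
  rewrite /c; case: (posnP b) => [b0|b_gt0]; last exact/ltnW/ltn_pmod.
  have m1 : (m <= 1)%N by rewrite leqNgt -half_gt0 -/b b0.
  have -> : g = 0%N by move: gm m1; clear; case: m => [|[|?]] //; lia.
  by rewrite mod0n.
(* Integrality sharpens [4 * g <= m ^ 2] to [g <= b * (m - b)]; for [b > 0], [q + r] is [g / b]
   rounded up, hence at most [m - b]. *)
have bqr : (b + q + r <= m)%N.
  have mE : (m = odd m + b + b)%N by rewrite -{1}[m]odd_double_half -addnn addnA.
  have gb : (g <= b * (odd m + b))%N.
    by move: gm; rewrite {1}mE; case: (odd m); clear; rewrite ?add0n ?add1n; nia.
  rewrite {1}mE -addnA [X in (_ <= X)%N]addnC leq_add2l.
  move: gb; rewrite gE /r; case: (posnP b) => [b0|b_gt0].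
    by rewrite /q /c b0 divn0 modn0 mul0n leqn0 => /eqP; case: (g).
  case: posnP => [->|c_gt0]; first by rewrite !addn0 mulnC leq_pmul2l.
  by rewrite addn1 => gb; rewrite -(ltn_pmul2l b_gt0) mulnC; apply: leq_trans gb;
    rewrite -addn1 leq_add2l.
have rE : r = (0 < c)%N by [].
clearbody r q c b.
pose p := (m - (b + q + r))%N.
have pE : (p + (b + q + r) = m)%N by rewrite /p subnK.
clearbody p.
have [||X1 [b1 [z1 [st1 n1]]]] := @stage1_iter p _ _ st 0 0; first exact: built_base.
  by apply: leq_trans mN; rewrite ltnS -pE leq_addr.
have st2 : stage2 X1 z1 y2 0.
  have [zN [h1 h2 h3 h4] [l1 l2 l3 l4 l5] _] := st1.
  split.
  - by move: zN; rewrite !inE !negb_or => /and5P[-> -> -> -> _].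
  - by move: zN; rewrite !inE !negb_or ![y2 == _]eq_sym => /and5P[_ _ _ _ ->]; neqs.
  - by [].
  - split=> //; first by rewrite -h4; apply: eq_lkpoly => i; rewrite !inE orbC.
    by rewrite -h3; apply: eq_lkpoly => i; rewrite !inE; by_cases_eq.
  - by [].
have [|X2 [b2 [w st2']]] := @stage2_iter c _ _ _ _ st2 _ _ b1.
  by move: pE cb mN; clear; lia.
have st3 : stage3 X2 z1 c c.
  by case: st2'.
have [|X3 [b3 [z3 [_ _ [e1 e2]]]]] := @stage3_iter (b - c) _ _ _ _ st3 _ _ b2.
  by move: pE cb mN; clear; lia.
rewrite subnKC // in e2.
have [X4 [b4 e4]] : exists X4, built X0 X4 (p.+1 + b + r) c /\
    lkpoly X4 [:: x1; x0] = cyclepoly b.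
  have e3 : lkpoly X3 [:: x1; x0] = cyclepoly b by rewrite -e2; apply: eq_lkpoly => i;
    rewrite !inE orbC.
  have -> : (p.+1 + b + r = p.+1 + c + (b - c) + r)%N by rewrite -(addnA _ c) subnKC.
  rewrite !addn0 in b3; case: (posnP c) => [c0|c_gt0].
    by exists X3; split=> //; move: b3; rewrite rE c0 !addn0.
  have [v fv] : exists v, fresh v X3 by apply: (fresh_ex b3); move: pE mN; rewrite rE c_gt0;
    clear -cb; lia.
  have vN : v \notin [:: x1; x2] by apply: (fresh_lkpoly fv); rewrite e1 cyclepoly_neq0.
  have vN' : v \notin [:: x1; x0] by apply: (fresh_lkpoly fv); rewrite e3 cyclepoly_neq0.
  exists (subdiv X3 x1 x2 v); split; last by neqs; rewrite lkpoly_subdiv_end ?inE //; neqs.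
  by rewrite rE c_gt0 addn1 -[X in built _ _ _ X]add0n; apply: built_subdiv b3 fv x12 e1.
have x10 : x1 != x0 by rewrite eq_sym.
have [|X5 [b5 _]] := @stage4_iter q _ _ _ x10 e4 _ _ b4.
  by move: pE cb mN; clear; lia.
exists X5; move: b5.
have -> : (p.+1 + b + r + q = m.+1)%N by move: pE; clear; lia.
by rewrite gE addnC.
Qed.

End Construction.

(** The link of a face of a cross-polytope is the cross-polytope on the antipodal pairs that the
    face does not meet. *)
Lemma lkpoly_cross ps l : uniq (unzip1 ps ++ unzip2 ps) -> {subset l <= unzip1 ps ++ unzip2 ps} ->
  lkpoly (crosspoly ps) l =
  if all (fun pq => ~~ ((pq.1 \in l) && (pq.2 \in l))) ps
  then (1 + 'X *+ 2) ^+ count (fun pq => (pq.1 \notin l) && (pq.2 \notin l)) ps else 0.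
Proof.
elim: ps l => [|[p q] ps IH] l U ls.
  rewrite lkpoly_cross0; case: l ls => [|x l] //= /(_ x).
  by rewrite inE eqxx => /(_ isT).
have [pq pN qN U0] := uniq_pairs U.
have mem_ps r : r \in unzip1 ps ++ unzip2 ps -> (r != p) /\ (r != q).
  by move=> rps; split; [apply: contraNneq pN | apply: contraNneq qN] => <-.
have filt (l' : seq T) : {subset l' <= l} -> {in predC (pred2 p q), l' =i l} -> p \notin l' ->
  q \notin l' ->
    lkpoly (crosspoly ps) l' = if all (fun pq => ~~ ((pq.1 \in l) && (pq.2 \in l))) ps
    then (1 + 'X *+ 2) ^+ count (fun pq => (pq.1 \notin l) && (pq.2 \notin l)) ps else 0.
  move=> l'l l'E pl' ql'; rewrite IH // => [|i il']; last first.
    have := ls _ (l'l _ il'); rewrite !mem_cat !inE.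
    have [/negPf-> /negPf->] : (i != p) /\ (i != q).
      by split; [apply: contraNneq pl' | apply: contraNneq ql'] => <-.
    by [].
  have e12 r : r \in ps -> ((r.1 \in l') = (r.1 \in l)) * ((r.2 \in l') = (r.2 \in l)).
    move=> rps; split; apply: l'E; rewrite !inE negb_or.
      by have [|-> ->] := mem_ps r.1; rewrite ?mem_cat ?map_f.
    by have [|-> ->] := mem_ps r.2; rewrite ?mem_cat ?map_f ?orbT.
  congr (if _ then _ ^+ _ else _).
    by apply: eq_in_all => r /e12[-> ->].
  by apply: eq_in_count => r /e12[-> ->].
rewrite lkpoly_cross_cons //=.
case: ifPn => pl; case: ifPn => ql //=; rewrite ?add0n ?add1n.
- apply: filt => [i|i| |]; rewrite ?mem_filter ?eqxx //; first by case/andP.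
    by rewrite !inE negb_or => /andP[->].
  by rewrite (negPf ql) andbF.
- apply: filt => [i|i| |]; rewrite ?mem_filter ?eqxx //; first by case/andP.
    by rewrite !inE negb_or => /andP[_ ->].
  by rewrite (negPf pl) andbF.
- by rewrite filt // exprS; case: ifP; rewrite ?mulr0.
Qed.

Section CrossPolytope.
Variables x0 x1 x2 x3 y0 y1 y2 y3 : T.
Let vs := [:: x0; x1; y0; y1; x2; x3; y2; y3].
Hypothesis U : uniq vs.
Let f := nth x0 vs.
Let X0 := crosspoly [:: (x0, x2); (x1, x3); (y0, y2); (y1, y3)].

(* In [vs], the vertices of index [i] and [i + 4] are antipodal: memberships then
   reduce to computations on numerals. *)
Lemma lkpoly_cross4 (ns : seq nat) : all (gtn 8) ns ->
  lkpoly X0 (map f ns) =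
  if all (fun i => ~~ ((i \in ns) && (i + 4 \in ns)%N)) (iota 0 4)
  then (1 + 'X *+ 2) ^+ count (fun i => (i \notin ns) && (i + 4 \notin ns)%N) (iota 0 4) else 0.
Proof.
move=> /allP ns8; rewrite lkpoly_cross //=; last first.
  by move=> _ /mapP[i /ns8 i8 ->]; apply: mem_nth.
have mem i : (i < 8)%N -> (f i \in map f ns) = (i \in ns).
  move=> i8; apply/mapP/idP => [[j jns /eqP]|ins]; last by exists i.
  by have j8 := ns8 j jns; rewrite nth_uniq // => /eqP ->.
by rewrite -!mem.
Qed.

Lemma stage1_cross : stage1 x0 x1 x2 y1 y2 X0 y0 /\ lkpoly X0 [::] = fgamma 0 0.
Proof.
split; last by rewrite (lkpoly_cross4 (ns := [::])) // /fgamma !mulr0n !addr0.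
split.
- apply/negP => y0in; move: U; rewrite /vs.
  rewrite (perm_uniq (_ : perm_eq _ (y0 :: [:: x0; x1; x2; y1; y2; x3; y3]))); last first.
    by apply/permP => a /=; lia.
  by case/andP => /negP[]; move: y0in; rewrite !inE => /or4P[|||/orP[]] -> ; rewrite ?orbT.
- rewrite -cyclepoly0; split.
  (* The indices 0 to 7 stand for [x0], [x1], [y0], [y1], [x2], [x3], [y2], [y3]. *)
  + exact: (lkpoly_cross4 (ns := [:: 0; 2])%N).
  + exact: (lkpoly_cross4 (ns := [:: 0; 2; 3])%N).
  + exact: (lkpoly_cross4 (ns := [:: 0; 2; 3; 1])%N).
  + exact: (lkpoly_cross4 (ns := [:: 2; 3])%N).
- rewrite -cyclepoly0; split.
  + exact: (lkpoly_cross4 (ns := [:: 1; 4])%N).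
  + exact: (lkpoly_cross4 (ns := [:: 0; 1])%N).
  + exact: (lkpoly_cross4 (ns := [:: 3; 6])%N).
  + exact: (lkpoly_cross4 (ns := [:: 3; 6; 1; 4])%N).
  + exact: (lkpoly_cross4 (ns := [:: 3; 6; 0; 1])%N).
- split.
  + exact: (lkpoly_cross4 (ns := [:: 0; 2; 1; 4])%N).
  + exact: (lkpoly_cross4 (ns := [:: 0; 2; 3; 6])%N).
  + exact: (lkpoly_cross4 (ns := [:: 0; 2; 3; 1; 4])%N).
  + exact: (lkpoly_cross4 (ns := [:: 0; 2; 3; 6; 1; 4])%N).
Qed.
End CrossPolytope.

Lemma exists_built x0 x1 x2 x3 y0 y1 y2 y3 m g :
  uniq [:: x0; x1; y0; y1; x2; x3; y2; y3] -> (4 * g <= m ^ 2)%N -> (8 + m.+1 <= #|T|)%N ->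
  exists2 X : {set {set T}},
    built (crosspoly [:: (x0, x2); (x1, x3); (y0, y2); (y1, y3)]) X m.+1 g
    & lkpoly X [::] = fgamma m.+1 g.
Proof.
move=> U gm mT; set X0 := crosspoly _.
have [st F0] := stage1_cross U.
have fe X k n : built X0 X k n -> (k < m.+1)%N -> exists v, fresh v X.
  move=> bX km.
  have [u|V] := built_supp (V0 := [set:: [:: x0; x1; y0; y1; x2; x3; y2; y3]]) _ bX.
    by rewrite in_cross // => /andP[].
  rewrite cardsE (card_uniqP U) => cV XV.
  have /existsP[v vV] : [exists v, v \notin V].
    rewrite -negb_forall; apply/negP => /forallP VT.
    have : (#|T| <= #|V|)%N by apply: subset_leq_card; apply/subsetP => i _; apply: VT.
    by rewrite leqNgt (leq_ltn_trans cV) // (leq_trans _ mT) // /= ltn_add2l.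
  by exists v => u /XV /subsetP uV; apply: contra vV; apply: uV.
have [X bX] : exists X, built X0 X m.+1 g.
  move: U; rewrite /= !inE !negb_or -!andbA; do 27 case/andP=> ?; move=> _.
  by apply: (exists_built_from_stage1 fe _ _ _ _ _ _ _ _ _ _ st gm) => //; rewrite eq_sym.
by exists X => //; apply: lkpoly_built bX.
Qed.

End EdgeSubdivisions.

(** * Topology *)

Section FlagComplexes.
Import fintype boot.finset.
Variable n : nat.
Implicit Types X : {set {set 'I_n}}.

Lemma simplicial_subdiv X a b v : simplicial_complex X -> simplicial_complex (subdiv X a b v).
Proof.
move=> [X0 Xsub]; split=> [|s t]; first by rewrite !inE.
rewrite !inE => /andP[abs sX] ts; apply/andP; split.
  by apply: contra abs => /andP[/(subsetP ts)-> /(subsetP ts)->].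
case: ifPn => vt.
  rewrite (subsetP ts _ vt) in sX.
  by apply: Xsub sX _; rewrite !setUS // setSD.
case: ifP sX => vs sX; last exact: Xsub sX ts.
apply: Xsub sX _; apply/subsetP => i it; rewrite !inE (subsetP ts _ it) andbT.
by case: (eqVneq i v) it => [->|_ _]; rewrite ?orbT // (negPf vt).
Qed.

(** If [v] is in [S], adjacency to [v] puts each other vertex of [S] in a common face of [X] with
    [a] and [b]; so [S] with [v] replaced by both ends is pairwise adjacent in [X], hence a face.
    The ends are never both in [S], since [ab] is no longer an edge. *)
Lemma flag_subdiv X a b v : simplicial_complex X -> flag_complex X ->
  flag_complex (subdiv X a b v).
Proof.
move=> [X0 Xsub] flX S pairs.
have pX x y : x \in S -> y \in S -> x != v -> y != v -> [set x; y] \in X.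
  move=> xS yS xv yv; have := pairs x y xS yS; rewrite inE => /andP[_].
  by rewrite !inE ![v == _]eq_sym (negPf xv) (negPf yv).
rewrite inE; apply/andP; split.
  by apply/negP => /andP[aS bS]; have := pairs a b aS bS; rewrite !inE !eqxx orbT.
case: ifPn => vS; last first.
  by apply: flX => x y xS yS; apply: pX => //; [move: xS|move: yS]; apply: contraTneq => ->.
have cone x : x \in S -> [set a; b; x] \in X \/ x = v.
  move=> xS; have := pairs v x vS xS; rewrite inE => /andP[_]; rewrite !inE eqxx /= => sX.
  case: (eqVneq x v) => [->|xv]; [by right | left].
  apply: Xsub sX _.
  by apply/subsetP => i; rewrite !inE => /orP[/orP[]|] /eqP ->; rewrite ?eqxx ?xv ?orbT.
have abX : [set a; b] \in X.
  have := pairs v v vS vS; rewrite inE => /andP[_]; rewrite !inE eqxx /= => /Xsub; apply.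
  by apply/subsetP => i; rewrite !inE => /orP[] ->; rewrite ?orbT.
apply: flX => x y; rewrite !inE => xT yT.
have inT z : [|| z == a, z == b | (z != v) && (z \in S)] ->
    z \in [set a; b] \/ [/\ z != v, z \in S & [set a; b; z] \in X].
  rewrite !inE orbA => /orP[->|/andP[zv zS]]; [by left | right].
  by case: (cone z zS) => [//|/eqP]; rewrite (negPf zv).
have [xab|[xv xS xX]] := inT _ xT; have [yab|[yv yS yX]] := inT _ yT.
- by apply: Xsub abX _; apply/subsetP => i; rewrite !inE => /orP[] /eqP ->; move: xab yab;
  rewrite !inE.
- by apply: Xsub yX _; apply/subsetP => i; move: xab; rewrite !inE => xab /orP[] /eqP ->;
  rewrite ?xab ?eqxx ?orbT.
- by apply: Xsub xX _; apply/subsetP => i; move: yab; rewrite !inE => yab /orP[] /eqP ->;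
  rewrite ?yab ?eqxx ?orbT.
- exact: pX.
Qed.

Lemma simplicial_cross ps : uniq (unzip1 ps ++ unzip2 ps) ->
  simplicial_complex (crosspoly ps : {set {set 'I_n}}).
Proof.
move=> U; split=> [|s t]; rewrite !in_cross //.
  by rewrite sub0set andbT; apply/allP => r _; rewrite !inE.
move=> /andP[/allP nb sV] ts; apply/andP; split; last exact: subset_trans sV.
by apply/allP => r /nb; apply: contra => /andP[/(subsetP ts)-> /(subsetP ts)->].
Qed.

Lemma flag_cross ps : uniq (unzip1 ps ++ unzip2 ps) ->
  flag_complex (crosspoly ps : {set {set 'I_n}}).
Proof.
move=> U S pairs; rewrite in_cross //; apply/andP; split.
  apply/allP => r rps; apply/negP => /andP[r1 r2].
  have := pairs _ _ r1 r2; rewrite in_cross // => /andP[/allP/(_ r rps)].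
  by rewrite !inE !eqxx orbT.
apply/subsetP => i iS; have := pairs _ _ iS iS; rewrite in_cross // => /andP[_ /subsetP].
by apply; rewrite !inE eqxx.
Qed.

End FlagComplexes.

(** * Edge subdivision preserves the geometric realization *)

Section Homeomorphisms.
Import numFieldNormedType.Exports.
Import fintype boot.finset.
Local Open Scope classical_set_scope.
Variable R : realType.

Lemma homeomorphic_trans m k p (A : set 'rV[R]_m) (B : set 'rV[R]_k) (C : set 'rV[R]_p) :
  homeomorphic A B -> homeomorphic B C -> homeomorphic A C.
Proof.
move=> [f [g [cf cg fA gB [gf fg]]]] [f' [g' [cf' cg' fB gC [gf' fg']]]].
have comp m1 m2 m3 (D : set 'rV[R]_m1) (E : set 'rV[R]_m2) (h : 'rV[R]_m1 -> 'rV[R]_m2)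
    (h' : 'rV[R]_m2 -> 'rV[R]_m3) : h @` D `<=` E ->
    {within D, continuous h} -> {within E, continuous h'} -> {within D, continuous (h' \o h)}.
  move=> hD /subspace_continuousP ch /subspace_continuousP ch';
    apply/subspace_continuousP => x Dx.
  apply: cvg_comp (ch' _ (hD _ _)); last by exists x.
  move=> V WV; have := ch x Dx _ WV.
  rewrite /= /within /= !nbhs_simpl /=; apply: filterS => z /= DzV Dz; apply: (DzV Dz).
  by apply: hD; exists z.
exists (f' \o f), (g \o g'); split.
- exact: comp fA cf cf'.
- exact: comp gC cg' cg.
- by move=> _ [x Ax <-]; apply: fB; exists (f x) => //; apply: fA; exists x.
- by move=> _ [x Ax <-]; apply: gB; exists (g' x) => //; apply: gC; exists x.
- split=> x Ax /=; first by rewrite gf' ?gf //; apply: fA; exists x.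
  by rewrite fg ?fg' //; apply: gC; exists x.
Qed.

Lemma homeomorphic_sym m k (A : set 'rV[R]_m) (B : set 'rV[R]_k) :
  homeomorphic A B -> homeomorphic B A.
Proof. by move=> [f [g [cf cg fA gB [gf fg]]]]; exists g, f; split. Qed.

Lemma continuous_row m k (h : 'rV[R]_m -> 'rV[R]_k) x :
  (forall j, {for x, continuous (fun y => h y ord0 j)}) -> {for x, continuous h}.
Proof.
move=> ch; apply/(@cvg_ballP _ _ _ (nbhs x) (nbhs_filter x)) => e e0.
have H : \forall y \near x, forall j, ball (h x ord0 j) e (h y ord0 j).
  apply: (@filter_forall _ _ _ _ (nbhs_filter x)) => j.
  by have /cvg_ballP := ch j; exact.
apply: (@filterS _ _ (nbhs_filter x) _ _ _ H) => y Hy; split=> // i j.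
by rewrite (ord1 i).
Qed.

(* In barycentric coordinates the mass [min x_a x_b] is removed from both [a] and [b]
   and moved to the midpoint [v]; the inverse gives half of the mass of [v] to each end. *)
Lemma subdiv_homeomorphic n (X : {set {set 'I_n}}) (a b v : 'I_n) : fresh v X -> a != b ->
  v != a -> v != b ->
  homeomorphic (@geom_real R n X) (@geom_real R n (subdiv X a b v)).
Proof.
move=> fv ab va vb.
(* Moving by [- t *: d] takes mass [t] from each of [a] and [b] and puts [2 t] on [v]; the total is
   preserved because the entries of [d] add up to 0. *)
pose d : 'rV[R]_n := \row_i ((i == a)%:R + (i == b)%:R - 2%:R * (i == v)%:R).
pose f (x : 'rV[R]_n) := x - Num.min (x ord0 a) (x ord0 b) *: d.
pose g (x : 'rV[R]_n) := x + (x ord0 v / 2%:R) *: d.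
have sumd : \sum_i d ord0 i = 0.
  have sum1 (c : 'I_n) : \sum_i ((i == c)%:R : R) = 1.
    by rewrite (bigD1 c) //= eqxx big1 ?addr0 // => i /negPf ->.
  under eq_bigr do rewrite mxE.
  by rewrite sumrB big_split /= -mulr_sumr !sum1; ring.
have [da db dv] : [/\ d ord0 a = 1, d ord0 b = 1 & d ord0 v = - 2%:R].
  by rewrite !mxE !eqxx (negPf ab) (negPf va) (negPf vb) ![_ == v]eq_sym (negPf va) (negPf vb)
    [b == a]eq_sym (negPf ab) /= mulr1n !mulr0n; split; ring.
have dE i : i != a -> i != b -> i != v -> d ord0 i = 0.
  by move=> /negPf ia /negPf ib /negPf iv; rewrite mxE ia ib iv /= !mulr0n; ring.
have xv0 x : @geom_real R n X x -> x ord0 v = 0.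
  move=> [_ [_ /fv]]; rewrite inE negbK => /eqP //.
have fE x i : f x ord0 i = x ord0 i - Num.min (x ord0 a) (x ord0 b) * d ord0 i by rewrite !mxE.
have gE x i : g x ord0 i = x ord0 i + x ord0 v / 2%:R * d ord0 i by rewrite !mxE.
have caseI (P : 'I_n -> Prop) : P a -> P b -> P v -> (forall i, i != a -> i != b -> i != v ->
  P i) -> forall i, P i.
  by move=> Pa Pb Pv PI i; case: (eqVneq i a) => [->//|ia]; case: (eqVneq i b) => [->//|ib];
    case: (eqVneq i v) => [->//|iv]; apply: PI.
have fA x : @geom_real R n X x -> @geom_real R n (subdiv X a b v) (f x).
  move=> gx; have [x0 [xs xX]] := gx; have xv := xv0 x gx.
  have [xa xb] := (x0 a, x0 b).
  split; last split.
  - apply: caseI => [|||i ia ib iv]; rewrite fE ?da ?db ?dv ?dE ?mulr0 ?subr0 ?xv // ?mulr1;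
    case: (leP (x ord0 a) (x ord0 b)) => h; lra.
  - under eq_bigr do rewrite fE.
    by rewrite sumrB -mulr_sumr sumd xs mulr0 subr0.
  - rewrite inE; apply/andP; split.
      by rewrite !inE !fE da db !mulr1; case: leP => _; rewrite subrr eqxx ?andbF.
    (* If the minimum is 0, the point is fixed and [v] stays outside its support. Otherwise [v]
       enters the support, and trading it back for [a] and [b] gives the support of [x]. *)
    have [s0|s_gt0] := eqVneq (Num.min (x ord0 a) (x ord0 b)) 0.
      have -> : f x = x by rewrite /f s0 scale0r subr0.
      by rewrite inE xv eqxx.
    rewrite inE fE xv dv ifT; last by apply: contra s_gt0; move/eqP => e; apply/eqP; lra.
    rewrite (_ : setU _ _ = finset (fun i => x ord0 i != 0)) //; apply/setP; rewrite /eq_mem.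
    have [xan xbn] : x ord0 a != 0 /\ x ord0 b != 0.
      by move: s_gt0; case: leP => h s_gt0; split; apply: contra s_gt0 => /eqP e; apply/eqP; lra.
    apply: caseI => [|||i ia ib iv].
    + by rewrite !inE eqxx xan.
    + by rewrite !inE eqxx orbT xbn.
    + by rewrite !inE eqxx xv (negPf va) (negPf vb) eqxx.
    + by rewrite !inE fE dE // mulr0 subr0 (negPf ia) (negPf ib) iv.
have gA x : @geom_real R n (subdiv X a b v) x -> @geom_real R n X (g x).
  move=> [x0 [xs]]; rewrite inE => /andP[ab0 xX].
  have [xa xb xv] := And3 (x0 a) (x0 b) (x0 v).
  split; last split.
  - by apply: caseI => [|||i ia ib iv]; rewrite gE ?da ?db ?dv ?dE ?mulr0 ?addr0 // ?mulr1; lra.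
  - under eq_bigr do rewrite gE.
    by rewrite big_split -mulr_sumr /= sumd xs mulr0 addr0.
  - move: xX; have [v0|v_gt0] := eqVneq (x ord0 v) 0.
      have -> : g x = x by rewrite /g v0 mul0r scale0r addr0.
      by rewrite inE v0 eqxx.
    rewrite inE v_gt0; rewrite (_ : setU _ _ = finset (fun i => g x ord0 i != 0)) //.
    have v1 : 0 < x ord0 v by rewrite lt_def v_gt0.
    apply/setP; rewrite /eq_mem; apply: caseI => [|||i ia ib iv].
    + by rewrite !inE eqxx gE da; symmetry; apply: lt0r_neq0; lra.
    + by rewrite !inE eqxx orbT gE db; symmetry; apply: lt0r_neq0; lra.
    + rewrite !inE eqxx gE dv (negPf va) (negPf vb) /=; symmetry; apply/negbTE; rewrite negbK;
      apply/eqP; lra.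
    + by rewrite !inE gE dE // mulr0 addr0 (negPf ia) (negPf ib) iv.
exists f, g; split.
- apply: continuous_subspaceT => x.
  apply: (@continuousB R 'rV[R]_n 'rV[R]_n id (fun y => Num.min (y ord0 a) (y ord0 b) *: d));
    first exact: cvg_id.
  apply: continuousZr_tmp; apply: (@continuous_min R _ (fun y : 'rV[R]_n => y ord0 a) (fun y =>
    y ord0 b)); exact: coord_continuous.
- apply: continuous_subspaceT => x.
  apply: (@continuousD R 'rV[R]_n 'rV[R]_n id (fun y => (y ord0 v / 2%:R) *: d));
    first exact: cvg_id.
  apply: continuousZr_tmp; apply: (@continuousM R 'rV[R]_n (fun y => y ord0 v) (fun=> 2%:R^-1)).
    exact: coord_continuous.
  exact: cst_continuous.
- by move=> _ [x gx <-]; apply: fA.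
- by move=> _ [x gx <-]; apply: gA.
split=> x gx.
  apply/rowP => i; rewrite [LHS]gE.
  by rewrite !fE dv (xv0 x gx); field.
have [x0 [xs]] := gx; rewrite inE => /andP[ab0 _].
apply/rowP => i; rewrite [LHS]fE !gE da db.
have [xa xb] := (x0 a, x0 b).
(* In the subdivision [a] and [b] span no face, so one of the two coordinates is 0 and the minimum
   is exactly the mass returned by [g]. *)
have -> : Num.min (x ord0 a + x ord0 v / 2%:R * 1) (x ord0 b + x ord0 v / 2%:R * 1) = x ord0 v /
  2%:R.
  move: ab0; rewrite !inE negb_and !negbK => /orP[] /eqP e; rewrite ?e; case: leP => h; lra.
by rewrite addrK.
Qed.

End Homeomorphisms.

Lemma maxDN (R : realDomainType) (t : R) : Num.max t 0 + Num.max (- t) 0 = `|t|.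
Proof.
case: (lerP 0 t) => t0.
  by rewrite (max_r (_ : - t <= 0)) ?oppr_le0 // ?(max_l t0) ?addr0 ?subr0 ?ger0_norm.
by rewrite (max_l (_ : 0 <= - t)) ?oppr_ge0 ?ltW // ?(max_r (ltW t0)) ?add0r ?sub0r ?opprK
  ?ltr0_norm.
Qed.

Lemma maxBN (R : realDomainType) (t : R) : Num.max t 0 - Num.max (- t) 0 = t.
Proof.
case: (lerP 0 t) => t0.
  by rewrite (max_r (_ : - t <= 0)) ?oppr_le0 // ?(max_l t0) ?addr0 ?subr0 ?ger0_norm.
by rewrite (max_l (_ : 0 <= - t)) ?oppr_ge0 ?ltW // ?(max_r (ltW t0)) ?add0r ?sub0r ?opprK
  ?ltr0_norm.
Qed.

(** * The boundary of the 4-dimensional cross-polytope is a 3-sphere *)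

Section CrossPolytopeSphere.
Import numFieldNormedType.Exports.
Import fintype boot.finset.
Local Open Scope classical_set_scope.
Variables (R : realType) (n : nat) (p q : 'I_4 -> 'I_n) (s : seq 'I_4).
Hypotheses (sT : forall i, i \in s) (Us : uniq s).
Hypotheses (pI : injective p) (qI : injective q) (pq : forall i j, (p i == q j) = false).
Let ps := [seq (p i, q i) | i <- s].

Lemma cross_pairsE : unzip1 ps ++ unzip2 ps = map p s ++ map q s.
Proof. by rewrite /ps /unzip1 /unzip2 -!map_comp. Qed.

Lemma uniq_cross_pairs : uniq (unzip1 ps ++ unzip2 ps).
Proof.
rewrite cross_pairsE cat_uniq !map_inj_uniq // Us andbT /=.
by apply/hasPn => _ /mapP[j _ ->]; apply/mapP => -[i _ /eqP]; rewrite eq_sym pq.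
Qed.

Lemma in_cross_pairs (u : {set 'I_n}) : (u \in crosspoly ps) =
  [forall i, ~~ ((p i \in u) && (q i \in u))] && [forall j in u, j \in map p s ++ map q s].
Proof.
rewrite in_cross ?uniq_cross_pairs // cross_pairsE; congr (_ && _).
  rewrite all_map; apply/allP/forallP => [H i|H i _]; [exact: H | exact: H].
by apply/subsetP/forall_inP => H j /H; rewrite inE.
Qed.

Lemma sum_cross (x : 'rV[R]_n) : (forall j, j \notin map p s ++ map q s -> x ord0 j = 0) ->
  \sum_j x ord0 j = \sum_i (x ord0 (p i) + x ord0 (q i)).
Proof.
move=> x0; rewrite (bigID (mem (map p s ++ map q s))) /= [X in _ + X]big1 // addr0.
have := uniq_cross_pairs; rewrite cross_pairsE => U.
rewrite -big_uniq // big_cat !big_map /= -big_split /= big_uniq //=.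
by apply: eq_bigl => i; rewrite sT.
Qed.

(** As [p i] and [q i] span no face, at most one of their coordinates is non-zero, and their
    difference is a signed coordinate from which both are recovered as positive and negative parts.
    This identifies the complex with the unit l^1 sphere of R^4. *)
Let D (x : 'rV[R]_n) i := x ord0 (p i) - x ord0 (q i).
Let N2 x := Num.sqrt (\sum_i D x i ^+ 2).
Let N1 (y : 'rV[R]_4) := \sum_i `|y ord0 i|.
Let f x : 'rV[R]_4 := \row_i (D x i / N2 x).
Let g (y : 'rV[R]_4) : 'rV[R]_n :=
  \row_j ((\sum_i ((j == p i)%:R * Num.max (y ord0 i) 0 + (j == q i)%:R * Num.max (- y ord0 i)
    0)) / N1 y).

Let gp y i : g y ord0 (p i) = Num.max (y ord0 i) 0 / N1 y.
Proof.
rewrite mxE; congr (_ / _); rewrite (bigD1 i) //= eqxx pq mul1r mul0r addr0 big1 ?addr0 // =>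
  k ki.
by rewrite pq (inj_eq pI) eq_sym (negPf ki) !mul0r addr0.
Qed.

Let gq y i : g y ord0 (q i) = Num.max (- y ord0 i) 0 / N1 y.
Proof.
rewrite mxE; congr (_ / _); rewrite (bigD1 i) //= eqxx eq_sym pq mul1r mul0r add0r big1 ?addr0
  // => k ki.
by rewrite eq_sym pq (inj_eq qI) eq_sym (negPf ki) !mul0r addr0.
Qed.

Let g0 y j : j \notin map p s ++ map q s -> g y ord0 j = 0.
Proof.
rewrite mem_cat negb_or => /andP[jp jq]; rewrite mxE big1 ?mul0r // => i _.
have -> : j == p i = false by apply: contraNF jp => /eqP ->; apply: map_f.
have -> : j == q i = false by apply: contraNF jq => /eqP ->; apply: map_f.
by rewrite !mul0r addr0.
Qed.

Let geomP x : @geom_real R n (crosspoly ps) x ->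
  [/\ forall j, 0 <= x ord0 j, \sum_i (x ord0 (p i) + x ord0 (q i)) = 1,
    forall j, j \notin map p s ++ map q s -> x ord0 j = 0
    & forall i, x ord0 (p i) = 0 \/ x ord0 (q i) = 0].
Proof.
move=> [x0 [xs]]; rewrite in_cross_pairs => /andP[/forallP npq /forall_inP xV].
have xo j : j \notin map p s ++ map q s -> x ord0 j = 0.
  by move=> jN; apply/eqP; apply: contraNT jN => xj; apply: xV; rewrite inE.
split=> //; first by rewrite -sum_cross.
by move=> i; have := npq i; rewrite !inE negb_and !negbK => /orP[] /eqP; [left|right].
Qed.

Let N2_gt0 x : @geom_real R n (crosspoly ps) x -> 0 < N2 x.
Proof.
move=> /geomP[x0 xs xo xpq]; rewrite sqrtr_gt0 lt_def sumr_ge0 ?andbT => [|i _];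
  last exact: sqr_ge0.
apply/eqP => /eqP; rewrite psumr_eq0 => [/allP D0|i _]; last exact: sqr_ge0.
move: xs; rewrite big1 => [/eqP|i _]; first by rewrite eq_sym oner_eq0.
have := D0 i (mem_index_enum _); rewrite /= sqrf_eq0 /D => /eqP.
by case: (xpq i) => ->; lra.
Qed.

Let N1_gt0 y : @sphere3 R y -> 0 < N1 y.
Proof.
move=> ys; rewrite lt_def sumr_ge0 ?andbT //.
apply/eqP => /eqP; rewrite psumr_eq0 => // /allP y0.
move: ys; rewrite /sphere3 /= big1 => [/eqP|i _]; first by rewrite eq_sym oner_eq0.
by have := y0 i (mem_index_enum _); rewrite /= normr_eq0 => /eqP ->; rewrite expr0n.
Qed.

Let N2_sqr x : \sum_i D x i ^+ 2 = N2 x ^+ 2.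
Proof. by rewrite sqr_sqrtr // sumr_ge0 // => i _; exact: sqr_ge0. Qed.

Lemma continuous_sum m (F : 'I_4 -> 'rV[R]_m -> R) :
  (forall i, continuous (F i)) -> continuous (fun x => \sum_i F i x).
Proof.
by move=> cF; apply: continuous_big => // x; exact: add_continuous.
Qed.

(* The radial projections between the unit sphere of the l^1 norm and that of the l^2 norm. *)
Lemma cross_homeomorphic : homeomorphic (@geom_real R n (crosspoly ps)) (@sphere3 R).
Proof.
have fA x : @geom_real R n (crosspoly ps) x -> @sphere3 R (f x).
  move=> gx; rewrite /sphere3 /=.
  under eq_bigr do rewrite mxE expr_div_n.
  by rewrite -mulr_suml N2_sqr divff // expf_neq0 // gt_eqF ?N2_gt0.
have gB y : @sphere3 R y -> @geom_real R n (crosspoly ps) (g y).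
  move=> ys; have n0 := N1_gt0 ys.
  split; last split.
  - move=> j; rewrite mxE divr_ge0 ?(ltW n0) // sumr_ge0 // => i _.
    by rewrite addr_ge0 // mulr_ge0 // ?ler0n // le_max lexx orbT.
  - rewrite sum_cross; last exact: g0.
    under eq_bigr => i _.
      rewrite gp gq -mulrDl.
      rewrite maxDN.
      over.
    by rewrite -mulr_suml divff // gt_eqF.
  - rewrite in_cross_pairs; apply/andP; split.
      apply/forallP => i; rewrite !inE gp gq negb_and !negbK.
      case: (lerP 0 (y ord0 i)) => yi.
        by rewrite [X in _ || (X / _ == 0)]max_r ?mul0r ?eqxx ?orbT // oppr_le0.
      by rewrite mul0r eqxx.
    apply/forall_inP => j; rewrite inE; apply: contraR => /g0 ->; exact/eqP.
have cD i x : {for x, continuous (D^~ i)}.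
  by apply: (@continuousB _ _ _ (fun y : 'rV[R]_n => y ord0 (p i)) (fun y => y ord0 (q i)));
    exact: coord_continuous.
exists f, g; split.
- apply: continuous_in_subspaceT => x /set_mem gx; apply: continuous_row => j.
  have -> : (fun y => f y ord0 j) = (fun y : 'rV[R]_n =>
    y ord0 (p j) - y ord0 (q j)) \* (fun y => (N2 y)^-1).
    by apply/funext => y; rewrite mxE.
  apply: continuousM; first by apply: continuousB; exact: coord_continuous.
  apply: continuousV; first by rewrite gt_eqF // N2_gt0.
  apply: (continuous_comp (f := fun y : 'rV[R]_n => \sum_i D y i ^+ 2));
    last exact: sqrt_continuous.
  move: x {gx}; apply: continuous_sum => i.
  have -> : (fun y => D y i ^+ 2) = (D^~ i) \* (D^~ i) by apply/funext.
  by move=> x; apply: continuousM; exact: cD.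
- apply: continuous_in_subspaceT => y /set_mem ys; apply: continuous_row => j.
  have -> : (fun y => g y ord0 j) = (fun y : 'rV[R]_4 =>
    \sum_i ((j == p i)%:R * Num.max (y ord0 i) 0 + (j == q i)%:R * Num.max (- y ord0 i) 0)) \*
    (fun y => (N1 y)^-1).
    by apply/funext => z; rewrite mxE.
  apply: continuousM; last first.
    apply: continuousV; first by rewrite gt_eqF // N1_gt0.
    move: y {ys}; apply: continuous_sum => i y.
    by apply: (continuous_comp (f := fun z : 'rV[R]_4 => z ord0 i));
      [exact: coord_continuous | exact: norm_continuous].
  move: y {ys}; apply: continuous_sum => i y.
  have cmax c (h : 'rV[R]_4 -> R) : {for y, continuous h} ->
    {for y, continuous (fun z => c * Num.max (h z) 0)}.
    move=> ch; apply: (@continuousM _ _ (fun=> c) (fun z => Num.max (h z) 0));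
      first exact: cst_continuous.
    by apply: (@continuous_max R _ h (fun=> 0)) => //; exact: cst_continuous.
  have cy : {for y, continuous (fun z : 'rV[R]_4 => z ord0 i)} by exact: coord_continuous.
  apply: (@continuousD _ _ _ (fun z : 'rV[R]_4 => (j == p i)%:R * Num.max (z ord0 i) 0)
    (fun z => (j == q i)%:R * Num.max (- z ord0 i) 0)); first exact: cmax.
  by apply: (cmax _ (fun z => - z ord0 i)); exact: continuousN.
- by move=> _ [x gx <-]; apply: fA.
- by move=> _ [y ys <-]; apply: gB.
split=> [x gx|y ys].
  have r0 := N2_gt0 gx; have [x0 xs xo xpq] := geomP gx.
  (* The absolute values of the [D x i] add up to the total mass 1, so dividing by [N2 x] leaves l^1
     norm [(N2 x)^-1], and normalising again undoes the division. *)
  have N1f : N1 (f x) = (N2 x)^-1.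
    rewrite /N1 -[RHS]mul1r -xs mulr_suml; apply: eq_bigr => i _.
    rewrite mxE normrM [ `|_^-1|]gtr0_norm ?invr_gt0 //; congr (_ * _); rewrite /D.
    by case: (xpq i) => ->; rewrite ?sub0r ?subr0 ?add0r ?addr0 ?normrN ger0_norm.
  apply/rowP => j; case: (boolP (j \in map p s ++ map q s)); last by move=> jN; rewrite g0 // xo.
  have mx (t : R) : 0 <= t -> Num.max (t / N2 x) 0 / (N2 x)^-1 = t.
    by move=> t0; rewrite max_l ?divr_ge0 ?(ltW r0) // invrK divfK // gt_eqF.
  have mxN (t : R) : 0 <= t -> Num.max (- (t / N2 x)) 0 / (N2 x)^-1 = 0.
    by move=> t0; rewrite max_r ?mul0r // oppr_le0 divr_ge0 ?(ltW r0).
  rewrite mem_cat => /orP[] /mapP[i _ ->].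
    rewrite gp N1f mxE /D; case: (xpq i) => e; rewrite e.
      by rewrite sub0r mulNr mxN.
    by rewrite subr0 mx.
  rewrite gq N1f mxE /D; case: (xpq i) => e; rewrite e.
    by rewrite sub0r mulNr opprK mx.
  by rewrite subr0 mxN.
have n0 := N1_gt0 ys.
have Dg i : D (g y) i = y ord0 i / N1 y.
  by rewrite /D gp gq -mulrBl maxBN.
have N2g : N2 (g y) = (N1 y)^-1.
  rewrite /N2; under eq_bigr do rewrite Dg expr_div_n.
  by rewrite -mulr_suml ys mul1r -exprVn sqrtr_sqr gtr0_norm // invr_gt0.
by apply/rowP => i; rewrite mxE Dg N2g invrK divfK // gt_eqF.
Qed.
End CrossPolytopeSphere.

(** * Numerical conditions *)

Lemma fpoly_lkpoly n (X : {set {set 'I_n}}) : fpoly X = lkpoly X [::].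
Proof.
rewrite /fpoly /lkpoly boot.finset.set_nil; apply: eq_big => [u|u _].
  by rewrite boot.finset.sub0set andbT.
by rewrite boot.finset.setD0.
Qed.

Lemma fgammaE k g : fgamma k g = Poly [:: 1; 8 + k%:R; 24 + 5 * k%:R + g%:R;
  32 + 8 * k%:R + 2 * g%:R; 16 + 4 * k%:R + g%:R].
Proof. by rewrite /fgamma /= !cons_poly_def; ring. Qed.

Lemma hgammaE g1 g2 : hgamma g1 g2 = Poly [:: 1; 4 + g1; 6 + 2 * g1 + g2; 4 + g1; 1].
Proof. by rewrite /hgamma /= !cons_poly_def; ring. Qed.

(** Both sides of the defining identity equal (t + 2)^4 + k (t + 1) (t + 2)^2 + g (t + 1)^2. *)
Lemma is_hpoly_lkpoly n (X : {set {set 'I_n}}) k g :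
  lkpoly X [::] = fgamma k g -> is_hpoly X (hgamma k%:R g%:R).
Proof.
move=> e; rewrite /is_hpoly fpoly_lkpoly e fgammaE hgammaE; split; try exact: size_Poly.
rewrite !big_ord_recl !big_ord0 !coef_Poly /= -!mul_polyC; ring.
Qed.

(** For a genuine quadratic 1 + B z + A z^2, the product 1/A of the negative roots is positive,
    their sum -B/A is negative, and the discriminant is the square of the real number A (r1 - r2).
    If A = 0, a negative B would give the positive root -1/B. *)
Lemma gamma_conditions (g1 g2 : int) :
  (forall z : algC, root (map_poly intr (gammapoly g1 g2 - 'X)) z ->
     z \is Num.real /\ z < 0) ->
  exists m g : nat, [/\ g1 = m.+1%:R, g2 = g%:R & (4 * g <= m ^ 2)%N].
Proof.
move=> H; pose B : algC := (g1 - 1)%:~R; pose A : algC := g2%:~R.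
have rootE z : root (map_poly intr (gammapoly g1 g2 - 'X)) z = (1 + B * z + A * z ^+ 2 == 0).
  rewrite rootE /gammapoly; congr (_ == 0).
  rewrite !(rmorphB, rmorphD, rmorphM, rmorph1, rmorphXn) /= !map_polyC !map_polyX /= !hornerE.
  by rewrite /A /B rmorphB /=; ring.
have {}H z : 1 + B * z + A * z ^+ 2 = 0 -> z < 0.
  by move/eqP; rewrite -rootE => /H[].
have fin : 0 <= g1 - 1 -> 0 <= g2 -> 4 * g2 <= (g1 - 1) ^+ 2 ->
    exists m g : nat, [/\ g1 = m.+1%:R, g2 = g%:R & (4 * g <= m ^ 2)%N].
  move=> g1_ge g2_ge disc; exists `|g1 - 1|%N, `|g2|%N; split.
  - by rewrite -addn1 natrD natz gez0_abs // subrK.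
  - by rewrite natz gez0_abs.
  - by rewrite -(ler_nat int) natrM natrX !natz !gez0_abs.
have [A0|A0] := eqVneq A 0.
  have g20 : g2 = 0 by apply/eqP; rewrite -(intr_eq0 algC) -/A A0.
  have B_ge0 : 0 <= g1 - 1.
    rewrite leNgt; apply/negP => B_lt0.
    have B0 : B < 0 by rewrite ltrz0.
    have := H (- B^-1); rewrite A0 mul0r addr0 mulrN divff ?lt_eqF // subrr => /(_ erefl).
    by rewrite oppr_lt0 invr_gt0 lt_gtF.
  by apply: fin; rewrite // g20 // mulr0 sqr_ge0.
pose s := sqrtC (B ^+ 2 - 4 * A).
have sE : s ^+ 2 = B ^+ 2 - 4 * A by exact: sqrtCK.
pose r1 := (- B + s) / (2 * A); pose r2 := (- B - s) / (2 * A).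
have h1 : r1 < 0.
  apply: H; rewrite (_ : _ + _ = (s ^+ 2 - (B ^+ 2 - 4 * A)) / (4 * A)).
    by rewrite sE subrr mul0r.
  by rewrite /r1; field.
have h2 : r2 < 0.
  apply: H; rewrite (_ : _ + _ = (s ^+ 2 - (B ^+ 2 - 4 * A)) / (4 * A)).
    by rewrite sE subrr mul0r.
  by rewrite /r2; field.
have rM : r1 * r2 = A^-1.
  rewrite (_ : r1 * r2 = (B ^+ 2 - s ^+ 2) / (4 * A ^+ 2)); last by rewrite /r1 /r2; field.
  by rewrite sE; field.
have A_gt0 : 0 < A by rewrite -invr_gt0 -rM nmulr_rgt0.
have B_gt0 : 0 < B.
  have -> : B = A * - (r1 + r2) by rewrite /r1 /r2; field.
  by rewrite mulr_gt0 // oppr_gt0 -[0]addr0 ltrD.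
have D_ge0 : 0 <= B ^+ 2 - 4 * A.
  have -> : B ^+ 2 - 4 * A = (A * (r1 - r2)) ^+ 2 by rewrite -sE /r1 /r2; field.
  have r12 : r1 - r2 \is Num.real by rewrite realB // ltr0_real.
  by rewrite real_exprn_even_ge0 // realM // gtr0_real.
apply: fin.
- by rewrite -(ler0z algC) ltW.
- by rewrite -(ler0z algC) ltW.
- by move: D_ge0; rewrite subr_ge0 -(ler_int algC) /A /B rmorphXn rmorphM.
Qed.

Theorem theorem3p2p1 (R : realType) (g1 g2 : int) :
  (forall z : algC, root (map_poly intr (gammapoly g1 g2 - 'X)) z ->
     z \is Num.real /\ z < 0) ->
  exists (n : nat) (X : {set {set 'I_n}}),
    [/\ simplicial_complex X, flag_complex X, triangulates_S3 R X &
        is_hpoly X (hgamma g1 g2)].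
Proof.
move=> /gamma_conditions[m [g [-> -> gm]]].
(* Eight vertices for the cross-polytope and one for each subdivision. *)
pose n := (8 + m.+1)%N.
have lt8 (i : 'I_8) : (i < n)%N by apply: leq_trans (ltn_ord i) _; exact: leq_addr.
pose v i : 'I_n := Ordinal (lt8 i).
have vI : injective v by move=> i j /(congr1 val) /= ij; apply: val_inj.
pose p (i : 'I_4) := v (lshift 4 i); pose q (i : 'I_4) := v (rshift 4 i).
have pI : injective p by move=> i j /vI e; apply: (@lshift_inj 4 4).
have qI : injective q by move=> i j /vI e; apply: (@rshift_inj 4 4).
have pq i j : (p i == q j) = false by rewrite (inj_eq vI); exact: (@eq_lrshift 4 4).
pose s : seq 'I_4 := [:: @Ordinal 4 0 isT; @Ordinal 4 1 isT; @Ordinal 4 2 isT; @Ordinal 4 3 isT].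
have Us : uniq s by [].
have sT i : i \in s by case: i => [[|[|[|[|]]]]].
have Uv := uniq_cross_pairs Us pI qI pq.
have [||X bX fX] := @exists_built 'I_n (p (nth ord0 s 0)) (p (nth ord0 s 1)) (q (nth ord0 s 0))
  (q (nth ord0 s 1)) (p (nth ord0 s 2)) (p (nth ord0 s 3)) (q (nth ord0 s 2)) (q (nth ord0 s 3))
  m g _ gm.
- by move: Uv; rewrite cross_pairsE.
- by rewrite card_ord.
exists n, X.
have : [/\ simplicial_complex X, flag_complex X & triangulates_S3 R X].
  elim: bX => [|Y k g' a b w d _ [sY fY tY] fw ab e].
    split; [exact: simplicial_cross | exact: flag_cross | exact:
      (cross_homeomorphic R sT Us pI qI pq)].
  have /norP[wa /norP[wb _]] : w \notin [:: a; b] by apply: (fresh_lkpoly fw);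
    rewrite e cyclepoly_neq0.
  split; [exact: simplicial_subdiv | exact: flag_subdiv | ].
  apply: homeomorphic_trans tY; apply: homeomorphic_sym; exact: subdiv_homeomorphic.
by move=> [? ? ?]; split=> //; apply: is_hpoly_lkpoly fX.
Qed.
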